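(* Let $P=(p_i)_{i\in\mathbb N}$ be a probability distribution on $\mathbb N=\{1,2,3,\dots\}$ with $p_i\in(0,1)$ for all $i$ and $\sum_{i=1}^{\infty}p_i=1$. For $x\in[0,1)$ write $x=\pi_P(i_1,i_2,\dots)$ for its expansion induced by $P$, and let $\sigma$ be the shift operator on these expansions. Consider the system of functional equations for an unknown function $h$ on $[0,1)$: $$h\left(\sigma^{n-1}(x)\right)=\frac{1}{2^{i_n}}\left(1-h\left(\sigma^{n}(x)\right)\right),\qquad n=1,2,\dots,\ x=\pi_P(i_1,i_2,\dots)\in[0,1),$$ where $\sigma^0(x)=x$. In the class of functions that are defined and bounded on $[0,1)$, this system has the unique solution $$h(x)=\frac{M_\pi(x)}{2}=2^{-i_1}-2^{-i_1-i_2}+\dots+(-1)^{n-1}2^{-i_1-i_2-\dots-i_n}+\cdots .$$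
   Context: Set $\widehat{p_1}=0$ and $\widehat{p_i}=\sum_{j=1}^{i-1}p_j$ for $i>1$. For a sequence $(i_k)_{k\ge1}\in\mathbb N^{\mathbb N}$ define $$\pi_P(i_1,i_2,\dots)=\widehat{p_{i_1}}+\sum_{k=1}^{\infty}\widehat{p_{i_{k+1}}}\,p_{i_1}p_{i_2}\cdots p_{i_k}.$$ It is known that $\pi_P:\mathbb N^{\mathbb N}\to[0,1)$ is a bijection, so every $x\in[0,1)$ has a unique digit sequence $(i_k)$ with $x=\pi_P((i_k))$. The shift operator $\sigma:[0,1)\to[0,1)$ is $\sigma(\pi_P(i_1,i_2,i_3,\dots))=\pi_P(i_2,i_3,\dots)$, and $\sigma^n$ is its $n$-th iterate. The Minkowski type function associated with $P$ is $M_\pi:[0,1)\to\mathbb R$, $M_\pi(\pi_P(i_1,i_2,\dots))=\sum_{k=1}^{\infty}(-1)^{k-1}2^{1-i_1-i_2-\dots-i_k}$. *)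

(* Defs.v *)
From mathcomp Require Import all_boot all_order all_algebra.
From mathcomp Require Import all_classical all_reals all_analysis.

Set Implicit Arguments.
Unset Strict Implicit.
Unset Printing Implicit Defensive.

Import Order.TTheory GRing.Theory Num.Theory.
Import numFieldNormedType.Exports.

Local Open Scope classical_set_scope.
Local Open Scope ring_scope.

(* A sequence (i_1, i_2, ...) of positive integers is encoded as i : nat -> nat
   with i k standing for i_{k+1}; positions start at 0, the digits at 1. *)
Definition digit_seq : set (nat -> nat) := [set i | forall k, (0 < i k)%N].

Definition shift_seq (i : nat -> nat) : nat -> nat := fun k => i k.+1.

(* The distribution is p : nat -> R, of which only the values at positive
   integers are used. *)
Definition phat (R : realType) (p : nat -> R) (m : nat) : R :=
  \sum_(1 <= j < m) p j.

Definition pi_P (R : realType) (p : nat -> R) (i : nat -> nat) : R :=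
  phat p (i 0%N) +
  limn (series (fun k => phat p (i k.+1) * \prod_(j < k.+1) p (i j))).

(* [pi_P p] is a bijection from [digit_seq] onto [0, 1[ when p is a probability
   distribution with values in ]0, 1[, so on [0, 1[ this is its inverse there. *)
Definition digits (R : realType) (p : nat -> R) : R -> nat -> nat :=
  'pinv_(fun=> (fun=> 1%N)) digit_seq (pi_P p).

Definition sigma (R : realType) (p : nat -> R) (x : R) : R :=
  pi_P p (shift_seq (digits p x)).

Definition minkowski_type (R : realType) (p : nat -> R) (x : R) : R :=
  limn (series (fun k =>
    (-1) ^+ k * (2 : R) ^ (1 - (\sum_(j < k.+1) digits p x j)%N%:Z))).

(* The n-th equation below, n >= 0, has i n = i_{n+1}. *)
Definition solves_system (R : realType) (p : nat -> R) (h : R -> R) : Prop :=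
  forall (x : R) (i : nat -> nat), x \in `[0, 1[ -> digit_seq i ->
    x = pi_P p i ->
  forall n : nat,
    h (iter n (sigma p) x) = 1 / 2 ^+ i n * (1 - h (iter n.+1 (sigma p) x)).

(* Main.v *)
Require Import Defs.
From mathcomp Require Import all_boot all_order all_algebra.
From mathcomp Require Import all_classical all_reals all_analysis.
From mathcomp Require Import ring lra.

Set Implicit Arguments.
Unset Strict Implicit.
Unset Printing Implicit Defensive.

Import Order.TTheory GRing.Theory Num.Theory.
Import numFieldNormedType.Exports.
Local Open Scope classical_set_scope.
Local Open Scope ring_scope.

(** Both [pi_P] and [M_pi / 2] are limits of series
    [sum_k alpha (i_k) * prod_(j < k) beta (i_j)]: with [alpha = phat p] and
    [beta = p] for the former, [alpha m = 2^-m] and [beta m = - 2^-m] for the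
    latter. Such a limit [L] satisfies
    [L i = alpha (i_1) + beta (i_1) * L (shift i)], and since [|beta|] is
    bounded by some [c < 1] it is the only bounded solution of this recursion
    along any orbit. Along the orbits of the shift this is the uniqueness
    claim; along those of the piecewise affine map
    [x |-> (x - phat p m) / p m] on [phat p m, phat p m.+1[ it is the
    surjectivity of [pi_P]. *)

Definition affine_series (R : realType) (alpha beta : nat -> R)
    (i : nat -> nat) : R^nat :=
  series (fun k => alpha (i k) * \prod_(j < k) beta (i j)).

Lemma affine_seriesS (R : realType) (alpha beta : nat -> R) i n :
  affine_series alpha beta i n.+1 =
  alpha (i 0%N) + beta (i 0%N) * affine_series alpha beta (shift_seq i) n.
Proof.
rewrite /affine_series /series /= big_nat_recl // big_ord0 mulr1 mulr_sumr.
by congr (_ + _); apply: eq_bigr => k _; rewrite big_ord_recl mulrCA.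
Qed.

Lemma digit_seq_shift i : digit_seq i -> digit_seq (shift_seq i).
Proof. by move=> i_gt0 k; apply: i_gt0. Qed.

Lemma iter_shift_seq i n k : iter n shift_seq i k = i (n + k)%N.
Proof. by elim: n k => //= n IHn k; rewrite /shift_seq IHn addnS. Qed.

(** * Convergence, recursion and uniqueness for affine series *)

Section AffineSeries.
Variables (R : realType) (alpha beta : nat -> R).
Hypothesis ab_le1 : forall m, (0 < m)%N -> `|alpha m| + `|beta m| <= 1.

(** Induction on [n]: peeling off the first term leaves [|alpha| + |beta| * s] with [s <= 1] by
    induction, and [ab_le1] closes the step. *)
Lemma affine_series_norm_le1 i n : digit_seq i ->
  [normed affine_series alpha beta i] n <= 1.
Proof.
have -> : [normed affine_series alpha beta i] =
    affine_series (Num.norm \o alpha) (Num.norm \o beta) i.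
  apply/funext => m; apply: eq_bigr => k _ /=.
  by rewrite normrM normr_prod.
elim: n i => [|n IHn] i i_gt0.
  by rewrite /affine_series /series /= big_nil.
rewrite affine_seriesS /=; apply: le_trans (ab_le1 (i_gt0 0%N)).
by rewrite lerD2l ler_piMr // IHn //; apply: digit_seq_shift.
Qed.

Lemma is_cvg_affine_series i : digit_seq i -> cvgn (affine_series alpha beta i).
Proof.
move=> i_gt0; apply: normed_cvg; apply: nondecreasing_is_cvgn.
  by apply: nondecreasing_series => *; apply: normr_ge0.
by exists 1 => _ [n _ <-]; apply: affine_series_norm_le1.
Qed.

Lemma affine_series_lim_norm_le1 i : digit_seq i ->
  `|limn (affine_series alpha beta i)| <= 1.
Proof.
move=> i_gt0.
have abs_le1 n : -1 <= affine_series alpha beta i n <= 1.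
  rewrite -ler_norml; apply: le_trans (affine_series_norm_le1 n i_gt0).
  exact: ler_norm_sum.
have cvg_ab := is_cvg_affine_series i_gt0.
rewrite ler_norml; apply/andP; split.
  by apply: limr_ge => //; apply: nearW => n; have /andP[] := abs_le1 n.
by apply: limr_le => //; apply: nearW => n; have /andP[] := abs_le1 n.
Qed.

Lemma affine_series_limE i : digit_seq i ->
  limn (affine_series alpha beta i) =
  alpha (i 0%N) + beta (i 0%N) * limn (affine_series alpha beta (shift_seq i)).
Proof.
move=> i_gt0; apply/cvg_lim => //; rewrite -cvg_shiftS.
under eq_fun do rewrite affine_seriesS.
apply: cvgD; first exact: cvg_cst.
by apply: cvgM; [exact: cvg_cst | exact/is_cvg_affine_series/digit_seq_shift].
Qed.

(** Here [f] moves along an orbit and [d] reads off a digit. [F] and the limit obey the same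
    recursion, so the [alpha] terms cancel and each step along the orbit multiplies their difference
    by some [beta]. After [n] steps it is at most [c ^+ n * (B + 1)], where [B] bounds [F] and [1]
    bounds the limit. *)
Lemma affine_series_lim_uniq (T : Type) (A : set T) (f : T -> T) (d : T -> nat)
    (F : T -> R) (B c : R) :
    0 <= c < 1 -> (forall m, (0 < m)%N -> `|beta m| <= c) ->
    (forall t, A t -> [/\ A (f t), (0 < d t)%N, `|F t| <= B &
       F t = alpha (d t) + beta (d t) * F (f t)]) ->
  forall t, A t ->
  F t = limn (affine_series alpha beta (fun k => d (iter k f t))).
Proof.
move=> /andP[c_ge0 c_lt1] beta_le FP.
have d_gt0 t : A t -> digit_seq (fun k => d (iter k f t)).
  move=> At k; have Ak : A (iter k f t) by elim: k => //= k /FP[].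
  by have [] := FP _ Ak.
pose L t := limn (affine_series alpha beta (fun k => d (iter k f t))).
have LE t : A t -> L t = alpha (d t) + beta (d t) * L (f t).
  move=> At; rewrite {1}/L (affine_series_limE (d_gt0 _ At)) /L.
  have -> // : shift_seq (fun k => d (iter k f t)) =
      fun k => d (iter k f (f t)).
  by apply/funext => k; rewrite /shift_seq iterSr.
have dist_le n t : A t -> `|F t - L t| <= c ^+ n * (B + 1).
  elim: n t => [|n IHn] t At; have [Aft dt_gt0 FtB Ft] := FP _ At.
    rewrite expr0 mul1r; apply: le_trans (ler_normB _ _) _.
    by apply: lerD => //; apply: affine_series_lim_norm_le1; apply: d_gt0.
  rewrite Ft LE // opprD addrACA subrr add0r -mulrBr normrM exprS -mulrA.
  by apply: ler_pM => //; [apply: beta_le | apply: IHn].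
move=> t At; apply/eqP; rewrite -subr_eq0 -normr_le0 -/(L t).
have cvg0 : (fun n => c ^+ n * (B + 1)) @ \oo --> (0 : R).
  rewrite -[X in _ --> X](mul0r (B + 1)).
  by apply: cvgM; [apply: cvg_expr; rewrite ger0_norm | exact: cvg_cst].
rewrite -(cvg_lim _ cvg0) //; apply: limr_ge; first by apply/cvg_ex; exists 0.
by apply: nearW => n; apply: dist_le.
Qed.

End AffineSeries.

(** * The expansion [pi_P] as a bijection onto [[0, 1[] *)

Section Expansion.
Variables (R : realType) (p : nat -> R).
Hypothesis p01 : forall i : nat, (0 < i)%N -> 0 < p i < 1.
Hypothesis psum : (fun n : nat => \sum_(1 <= i < n.+1) p i) @ \oo --> (1 : R).

Lemma phatS m : (0 < m)%N -> phat p m.+1 = phat p m + p m.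
Proof. by move=> m_gt0; rewrite /phat big_nat_recr. Qed.

Lemma phat_ge0 m : 0 <= phat p m.
Proof.
rewrite /phat big_nat_cond; apply: sumr_ge0 => j.
by rewrite andbT => /andP[/p01/andP[/ltW]].
Qed.

Lemma phat_homo : {homo phat p : m n / (m <= n)%N >-> m <= n}.
Proof.
apply: homo_leq => [//|y x z|]; first exact: le_trans.
move=> m; case: m => [|m]; first by rewrite /phat !big_geq.
by rewrite (phatS (ltn0Sn m)) lerDl ltW //; have /andP[] := p01 (ltn0Sn m).
Qed.

Lemma phat_lt1 m : phat p m < 1.
Proof.
(* Strictness is taken one index higher, since [phat p 0] and [phat p 1] are both the empty sum. *)
have lt_phat : phat p m.+1 < phat p m.+2.
  by rewrite (phatS (ltn0Sn m)) ltrDl; have /andP[] := p01 (ltn0Sn m).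
apply: le_lt_trans (phat_homo (leqnSn m)) (lt_le_trans lt_phat _).
rewrite -(cvg_lim _ psum) //; apply: (nondecreasing_cvgn_le _ _ m.+1).
  by move=> a b leab; apply: phat_homo.
by apply/cvg_ex; exists 1.
Qed.

Lemma phat_p_le1 m : (0 < m)%N -> `|phat p m| + `|p m| <= 1.
Proof.
move=> m_gt0; have /andP[p_gt0 _] := p01 m_gt0.
rewrite !ger0_norm ?phat_ge0 ?(ltW p_gt0) //.
by rewrite -phatS // ltW // phat_lt1.
Qed.

Lemma p_contracting :
  exists2 c, 0 <= c < 1 & forall m, (0 < m)%N -> `|p m| <= c.
Proof.
have /andP[p1_gt0 p1_lt1] := p01 (ltn0Sn 0).
(* For [m >= 2], [p 1 + p m <= phat p m.+1 < 1], hence [p m <= 1 - p 1]. *)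
exists (Order.max (p 1%N) (1 - p 1%N)).
  by rewrite le_max ltW //= gt_max p1_lt1 ltrBlDr ltrDl.
move=> [//|m] _; have /andP[pm_gt0 _] := p01 (ltn0Sn m).
rewrite (ger0_norm (ltW pm_gt0)) le_max; case: m {pm_gt0} => [|m].
  by rewrite lexx.
apply/orP; right; rewrite lerBrDl; apply: le_trans (ltW (phat_lt1 m.+3)).
rewrite (phatS (ltn0Sn m.+1)) lerD2r.
by rewrite (le_trans _ (phat_homo (isT : 2 <= m.+2)%N)) // /phat big_nat1.
Qed.

(** The separate head of [pi_P] is the term of index 0, with an empty product, so the partial sums
    match after a shift by one. *)
Lemma pi_PE i : digit_seq i -> pi_P p i = limn (affine_series (phat p) p i).
Proof.
move=> i_gt0; apply/esym/cvg_lim => //; rewrite -cvg_shiftS /pi_P.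
have seriesE n : affine_series (phat p) p i n.+1 = phat p (i 0%N) +
    series (fun k => phat p (i k.+1) * \prod_(j < k.+1) p (i j)) n.
  by rewrite /affine_series /series /= big_nat_recl // big_ord0 mulr1.
under eq_fun do rewrite seriesE.
apply: cvgD; first exact: cvg_cst.
have -> : series (fun k => phat p (i k.+1) * \prod_(j < k.+1) p (i j)) =
    (fun n => affine_series (phat p) p i n.+1 - phat p (i 0%N)).
  by apply/funext => n; rewrite seriesE addrC addKr.
apply: is_cvgB; last exact: is_cvg_cst.
have := is_cvg_affine_series phat_p_le1 i_gt0.
by move=> /cvg_ex[l cvgl]; apply/cvg_ex; exists l; rewrite cvg_shiftS.
Qed.

Lemma pi_P_rec i : digit_seq i ->
  pi_P p i = phat p (i 0%N) + p (i 0%N) * pi_P p (shift_seq i).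
Proof.
move=> i_gt0; rewrite !pi_PE //; last exact: digit_seq_shift.
exact: (affine_series_limE phat_p_le1).
Qed.

Lemma pi_P_ge0 i : digit_seq i -> 0 <= pi_P p i.
Proof.
move=> i_gt0; rewrite pi_PE //; apply: limr_ge.
  exact: (is_cvg_affine_series phat_p_le1 i_gt0).
apply: nearW => n; apply: sumr_ge0 => k _.
apply: mulr_ge0; first exact: phat_ge0.
by apply: prodr_ge0 => j _; have /andP[/ltW] := p01 (i_gt0 j).
Qed.

(** The tail is known only to be [<= 1], but this already gives [phat p (i 0).+1] as an upper bound,
    which is strictly below 1. *)
Lemma pi_P_lt1 i : digit_seq i -> pi_P p i < 1.
Proof.
move=> i_gt0; apply: le_lt_trans (phat_lt1 (i 0%N).+1).
rewrite pi_P_rec // phatS // lerD2l ler_piMr //.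
  by have /andP[/ltW] := p01 (i_gt0 0%N).
rewrite pi_PE; last exact: digit_seq_shift.
apply: le_trans (ler_norm _) _; apply: (affine_series_lim_norm_le1 phat_p_le1).
exact: digit_seq_shift.
Qed.

Lemma pi_P_head i : digit_seq i ->
  phat p (i 0%N) <= pi_P p i < phat p (i 0%N).+1.
Proof.
move=> i_gt0; have /andP[p_gt0 _] := p01 (i_gt0 0%N).
have shift_gt0 := digit_seq_shift i_gt0.
rewrite pi_P_rec // phatS // lerDl ltrD2l mulr_ge0 ?pi_P_ge0 ?ltW //=.
by rewrite gtr_pMr // pi_P_lt1.
Qed.

(** The cells [[phat p m, phat p m.+1[] are disjoint because [phat p] is monotone, so the value
    determines the first digit. *)
Lemma pi_P_head_inj i i' : digit_seq i -> digit_seq i' ->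
  pi_P p i = pi_P p i' -> i 0%N = i' 0%N.
Proof.
move=> i_gt0 i'_gt0 eq_pi.
have /andP[lb ub] := pi_P_head i_gt0.
have /andP[] := pi_P_head i'_gt0; rewrite -eq_pi => lb' ub'.
apply/eqP; case: ltngtP => // lt_i; exfalso.
- by have := lt_le_trans ub (le_trans (phat_homo lt_i) lb'); rewrite ltxx.
- by have := lt_le_trans ub' (le_trans (phat_homo lt_i) lb); rewrite ltxx.
Qed.

Lemma pi_P_inj : {in digit_seq &, injective (pi_P p)}.
Proof.
move=> i i'; rewrite !inE => i_gt0 i'_gt0 eq_pi; apply/funext => k.
(* Both sequences are generalised: once the first digits agree, the common affine map cancels and
   the shifted sequences have equal values. *)
elim: k i i' i_gt0 i'_gt0 eq_pi => [|k IHk] i i' i_gt0 i'_gt0 eq_pi.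
  exact: pi_P_head_inj.
apply: (IHk (shift_seq i) (shift_seq i')); try exact: digit_seq_shift.
have eq0 := pi_P_head_inj i_gt0 i'_gt0 eq_pi.
have /andP[p_gt0 _] := p01 (i_gt0 0%N).
move: eq_pi; rewrite (pi_P_rec i_gt0) (pi_P_rec i'_gt0) -eq0 => /addrI.
by apply: mulfI; rewrite gt_eqF.
Qed.

Lemma phat_cell x : 0 <= x < 1 ->
  exists m, (0 < m)%N && (phat p m <= x < phat p m.+1).
Proof.
move=> /andP[x_ge0 x_lt1].
have ex_n : exists n, x < phat p n.+1.
  have [N _ xN] : \forall n \near \oo, x < \sum_(1 <= i < n.+1) p i.
    by apply: (cvgr_gt 1).
  by exists N; apply: xN => /=.
(* The least [n] with [x < phat p n.+1] is the digit sought; it is not 0 because [phat p 1 = 0]. *)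
case: (ex_minnP ex_n) => -[|m] x_lt m_min.
  by move: x_lt; rewrite /phat big_geq // ltNge x_ge0.
by exists m.+1; rewrite x_lt andbT /= leNgt; apply/negP => /m_min; rewrite ltnn.
Qed.

Lemma pi_P_surj x : 0 <= x < 1 -> exists2 i, digit_seq i & pi_P p i = x.
Proof.
pose A := [set x : R | 0 <= x < 1].
have /choice[d dP] : forall x, exists m, A x ->
    (0 < m)%N && (phat p m <= x < phat p m.+1).
  move=> y; have [Ay|nAy] := pselect (A y); last by exists 0%N.
  by have [m mP] := phat_cell Ay; exists m.
pose f x := (x - phat p (d x)) / p (d x).
have fP y : A y -> [/\ A (f y), (0 < d y)%N, `|y| <= 1 &
    y = phat p (d y) + p (d y) * f y].
  move=> Ay; have /and3P[d_gt0 lb ub] := dP _ Ay.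
  have /andP[p_gt0 _] := p01 d_gt0; have /andP[y_ge0 y_lt1] := Ay.
  split=> //; last first.
  - by rewrite /f mulrC divfK ?gt_eqF // addrC subrK.
  - by rewrite ger0_norm // ltW.
  rewrite /A /= /f ltr_pdivrMr // mul1r ltrBlDl -phatS // ub andbT.
  by rewrite divr_ge0 ?subr_ge0 // ltW.
move=> Ax; have [c c01 p_le] := p_contracting.
have code_gt0 : digit_seq (fun k => d (iter k f x)).
  move=> k; have Ak : A (iter k f x) by elim: k => //= k /fP[].
  by have [] := fP _ Ak.
exists (fun k => d (iter k f x)) => //; rewrite pi_PE //.
(* By [fP] the identity is a bounded solution of the recursion along the orbit of [f], so [x] is the
   limit of its own series. *)
exact/esym/(affine_series_lim_uniq phat_p_le1 (F := id) c01 p_le fP).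
Qed.

Lemma digits_pi_P i : digit_seq i -> digits p (pi_P p i) = i.
Proof. by move=> i_gt0; apply: pinvKV; [exact: pi_P_inj | rewrite inE]. Qed.

Lemma iter_sigma_pi_P i n : digit_seq i ->
  digit_seq (iter n shift_seq i) /\
  iter n (sigma p) (pi_P p i) = pi_P p (iter n shift_seq i).
Proof.
move=> i_gt0; elim: n => //= n [n_gt0 ->]; split; first exact: digit_seq_shift.
by rewrite /sigma digits_pi_P.
Qed.

End Expansion.

(** * The alternating series for half the Minkowski type function *)

Section AlternatingSeries.
Variable R : realType.

(** With these coefficients a digit [m] acts by [t |-> 2^-m - 2^-m * t = 2^-m * (1 - t)], the
    right-hand side of the functional equation. *)
Definition dyadic (m : nat) : R := 2 ^- m.
Definition neg_dyadic (m : nat) : R := - 2 ^- m.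

Lemma expV2_le_half m : (0 < m)%N -> 2 ^- m <= 2^-1 :> R.
Proof.
case: m => // m _; rewrite lef_pV2 ?posrE ?exprn_gt0 //.
by rewrite exprS ler_peMr // exprn_ege1 // ler1n.
Qed.

Lemma alternating_le1 m : (0 < m)%N -> `|dyadic m| + `|neg_dyadic m| <= 1.
Proof.
move=> m_gt0; rewrite normrN ger0_norm ?invr_ge0 ?exprn_ge0 //.
by have := expV2_le_half m_gt0; rewrite /dyadic; lra.
Qed.

Lemma alternatingE i : affine_series dyadic neg_dyadic i =
  series (fun k => (-1) ^+ k * (2 : R) ^- (\sum_(j < k.+1) i j)%N).
Proof.
apply/funext => n; apply: eq_bigr => k _.
have -> : \prod_(j < k) neg_dyadic (i j) =
    (-1) ^+ k * 2 ^- (\sum_(j < k) i j)%N.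
  elim: (k) => [|m IHm]; first by rewrite !big_ord0 expr0 invr1 mulr1.
  by rewrite !big_ord_recr /= IHm exprD invfM exprSr /neg_dyadic; ring.
by rewrite big_ord_recr /= exprD invfM /dyadic; ring.
Qed.

Lemma minkowski_pi_P (p : nat -> R)
    (p01 : forall i : nat, (0 < i)%N -> 0 < p i < 1)
    (psum : (fun n : nat => \sum_(1 <= i < n.+1) p i) @ \oo --> (1 : R)) i :
  digit_seq i ->
  minkowski_type p (pi_P p i) / 2 = limn (affine_series dyadic neg_dyadic i).
Proof.
move=> i_gt0; rewrite /minkowski_type digits_pi_P //.
have cvg_ab := is_cvg_affine_series alternating_le1 i_gt0.
(* The factor 2 is the [1] in the integer exponent of [minkowski_type]. *)
rewrite (_ : series _ = fun n => 2 * affine_series dyadic neg_dyadic i n).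
  by rewrite (cvg_lim _ (cvgM (cvg_cst (2 : R)) cvg_ab)) // mulrC mulKf.
apply/funext => n; rewrite alternatingE /series /= mulr_sumr.
apply: eq_bigr => k _; rewrite expfzDr // expr1z -invr_expz -exprnP.
by rewrite mulrCA.
Qed.

End AlternatingSeries.

Theorem theorem2 (R : realType) (p : nat -> R)
    (p01 : forall i : nat, (0 < i)%N -> 0 < p i < 1)
    (psum : (fun n : nat => \sum_(1 <= i < n.+1) p i) @ \oo --> (1 : R)) :
  [/\ [bounded minkowski_type p x / 2 | x in `[0, 1[%classic],
      solves_system p (fun x => minkowski_type p x / 2),
      (forall h : R -> R,
         [bounded h x | x in `[0, 1[%classic] -> solves_system p h ->
         forall x : R, x \in `[0, 1[ -> h x = minkowski_type p x / 2) &
      (forall (x : R) (i : nat -> nat),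
         x \in `[0, 1[ -> digit_seq i -> x = pi_P p i ->
         series (fun k => (-1) ^+ k * (2 : R) ^- (\sum_(j < k.+1) i j)%N) @ \oo
           --> minkowski_type p x / 2)].
Proof.
have ab_le1 := @alternating_le1 R.
have surj (x : R) : x \in `[0, 1[ -> exists2 i, digit_seq i & pi_P p i = x.
  by rewrite in_itv /= => x01; apply: pi_P_surj.
split.
- exists 1; split=> [|M /ltW M_ge1 x /surj[i i_gt0 <-]]; first exact: num_real.
  rewrite /= minkowski_pi_P //.
  exact: le_trans (affine_series_lim_norm_le1 ab_le1 i_gt0) M_ge1.
- move=> x i _ i_gt0 -> n.
  have [n_gt0 ->] := iter_sigma_pi_P p01 psum n i_gt0.
  have [Sn_gt0 ->] := iter_sigma_pi_P p01 psum n.+1 i_gt0.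
  rewrite !minkowski_pi_P // (affine_series_limE ab_le1 n_gt0).
  by rewrite iter_shift_seq addn0 /= /dyadic /neg_dyadic; ring.
(* Boundedness supplies a bound for every number above [B]; [B + 1] is one such choice. *)
- move=> h [B [_ /(_ (B + 1) (ltr_pwDr ltr01 (lexx B))) hB]] solh x.
  move=> /surj[i i_gt0 <-].
  rewrite minkowski_pi_P //.
  (* Uniqueness is applied on digit sequences to [h \o pi_P p]; the digits read along the shift
     orbit of [i] are those of [i] itself. *)
  have := @affine_series_lim_uniq _ _ _ ab_le1 _ digit_seq shift_seq
    (fun i => i 0%N) (h \o pi_P p) (B + 1) 2^-1 _ _ _ i i_gt0.
  have -> : (fun k => iter k shift_seq i 0%N) = i.
    by apply/funext => k; rewrite iter_shift_seq addn0.
  apply.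
  + by rewrite invr_ge0 ler0n invf_lt1 ?ltr1n.
  + move=> m m_gt0; rewrite normrN ger0_norm ?invr_ge0 ?exprn_ge0 //.
    exact: expV2_le_half.
  move=> j j_gt0; have pi01 : pi_P p j \in `[0, 1[.
    by rewrite in_itv /= pi_P_ge0 ?pi_P_lt1.
  split=> //; [exact: digit_seq_shift | exact: hB |].
  (* The equation of index 0 at the point [pi_P p j] is exactly the recursion required. *)
  have /= -> := solh _ _ pi01 j_gt0 erefl 0%N.
  by rewrite /sigma digits_pi_P // /dyadic /neg_dyadic; ring.
- move=> x i _ i_gt0 ->; rewrite minkowski_pi_P // -alternatingE.
  exact: is_cvg_affine_series.
Qed.
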